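(* Let $A$, $B$ and $AB$ all be densely defined and closeable operators in a Hilbert space $H$. Then: (1) If $D(B^*A^* )$ is dense, then $\overline{AB}\subset\overline{\overline{A}\,\overline{B}}$. (2) In particular, if $\overline{B}$ is in $B(H)$ and $A$ is closed, then $\overline{AB}\subset A\overline{B}$. (3) Without $D(B^*A^* )$ necessarily being dense, $\overline{AB}\subset\overline{A}\,\overline{B}$ implies that $\overline{B}$ is relatively bounded with respect to $\overline{AB}$, and hence that $B$ is relatively bounded with respect to $AB$. (4) Also, without $D(B^*A^* )$ necessarily being dense, $\overline{A}\,\overline{B}\subset\overline{AB}$ implies that $\overline{A}\,\overline{B}$ is closeable and $\overline{\overline{A}\,\overline{B}}=\overline{AB}$.
   Context: Operators are linear, defined on linear subspaces (domains) $D(\cdot)$ of $H$, and not necessarily bounded. $B(H)$ denotes the everywhere defined bounded linear operators on $H$. $S\subset T$ means that $T$ extends $S$. Products carry their natural domains, e.g. $D(AB)=\{x\in D(B): Bx\in D(A)\}$. $\overline{T}$ denotes the closure of a closeable operator $T$. (When $D(B^*A^* )$ is dense, $\overline{A}\,\overline{B}$ is closeable, since $(\overline{A}\,\overline{B})^*\supset B^*A^*$.) An operator $S$ is relatively bounded with respect to $T$ (or $T$-bounded) if $D(T)\subset D(S)$ and there are constants $a,b\ge 0$ with $\|Sx\|\le a\|x\|+b\|Tx\|$ for all $x\in D(T)$. *)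

(* Defs.v *)
From HB Require Import structures.
From mathcomp Require Import all_boot all_order all_algebra.
From mathcomp Require Import all_classical all_reals all_analysis.
From mathcomp Require Import complex.
Set Implicit Arguments.
Unset Strict Implicit.
Unset Printing Implicit Defensive.
Import Order.TTheory GRing.Theory Num.Theory.
Import numFieldNormedType.Exports.
Local Open Scope classical_set_scope.
Local Open Scope ring_scope.

(* Inner products are linear in the first argument, conjugate-linear in the
   second. The norm takes its values in R[i]; it is then a nonnegative real,
   since [0 <= z] in R[i] means that z is real and nonnegative. *)
HB.mixin Record CompleteNormedModule_isHilbert (R : realType) H
    of CompleteNormedModule R[i] H := {
  inner : {dot H for Num.conj};
  sqr_normE : forall x : H, `|x| ^+ 2 = inner x x
}.

#[short(type="hilbertType")]
HB.structure Definition Hilbert (R : realType) :=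
  {H of CompleteNormedModule_isHilbert R H & CompleteNormedModule R[i] H}.

(* The values of [op_fun] outside [dom] are irrelevant. *)
Record operator (R : realType) (H : hilbertType R) := Operator {
  dom : set H;
  op_fun :> H -> H;
  dom0 : dom 0;
  domP : forall (a : R[i]) x y, dom x -> dom y -> dom (a *: x + y);
  op_linear : forall (a : R[i]) x y, dom x -> dom y ->
    op_fun (a *: x + y) = a *: op_fun x + op_fun y
}.

Section operators.
Context {R : realType} {H : hilbertType R}.
Implicit Types S T A B : operator H.

Definition suboperator S T := dom S `<=` dom T /\ forall x, dom S x -> S x = T x.

Definition same_op S T := dom S = dom T /\ forall x, dom S x -> S x = T x.

Definition graph T : set (H * H) := [set p | dom T p.1 /\ T p.1 = p.2].

Definition closed_op T := closed (graph T).

Definition closeable T := exists2 S, closed_op S & suboperator T S.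

Definition densely_defined T := dense (dom T).

Definition bounded_everywhere T :=
  dom T = setT /\ exists M : R[i], forall x, `|T x| <= M * `|x|.

Definition relatively_bounded S T := dom T `<=` dom S /\
  exists a b : R[i], [/\ 0 <= a, 0 <= b &
    forall x, dom T x -> `|S x| <= a * `|x| + b * `|T x|].

Lemma op_fun0 T : T 0 = 0.
Proof.
have := op_linear (-1) (dom0 T) (dom0 T).
by rewrite scaler0 addr0 scaleN1r addNr.
Qed.

Section product.
Variables A B : operator H.

Let D := [set x | dom B x /\ dom A (B x)].

Let D0 : D 0. Proof. by split; rewrite ?op_fun0; exact: dom0. Qed.

Let DP (a : R[i]) x y : D x -> D y -> D (a *: x + y).
Proof. by move=> [? ?] [? ?]; split; rewrite ?op_linear//; exact: domP. Qed.

Let mul_linear (a : R[i]) x y : D x -> D y ->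
  A (B (a *: x + y)) = a *: A (B x) + A (B y).
Proof. by move=> [? ?] [? ?]; rewrite !op_linear. Qed.

Definition mul_op := Operator D0 DP mul_linear.
End product.

Section closure_operator.
Variables (T : operator H) (cT : closeable T).

Let G : set (H * H) := closure (graph T).

Let G_fun x y y' : G (x, y) -> G (x, y') -> y = y'.
Proof.
have [S clS [sTS eTS]] := cT.
have sG : G `<=` graph S.
  rewrite /G (closure_id (graph S)).1//; apply: closure_subset => -[u v] [/= Tu <-].
  by split; [exact: sTS|rewrite /= eTS].
by move=> /sG [_ /= <-] /sG [_ /= <-].
Qed.

Let G_lin (a : R[i]) p q : G p -> G q -> G (a *: p + q).
Proof.
move=> Gp Gq N.
have cont : (fun z : (H * H) * (H * H) => a *: z.1 + z.2) @ (p, q) -->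
    a *: p + q.
  by apply: cvgD; [apply: cvgZr; exact: cvg_fst|exact: cvg_snd].
move=> /cont [[U V] /= [Up Vq] UV].
have [p' [[p1 p2] Up']] := Gp _ Up.
have [q' [[q1 q2] Vq']] := Gq _ Vq.
exists (a *: p' + q'); split; last exact: (UV (p', q')).
by split; [exact: domP|rewrite /= op_linear// p2 q2].
Qed.

Let D := [set x | exists y, G (x, y)].

Let f x := xget 0 [set y | G (x, y)].

Let fP x : D x -> G (x, f x).
Proof. exact: (@xgetPex _ 0 [set y | G (x, y)]). Qed.

Let D0 : D 0.
Proof.
exists 0; apply: subset_closure.
by split; [exact: dom0|exact: op_fun0].
Qed.

Let DP (a : R[i]) x y : D x -> D y -> D (a *: x + y).
Proof. by move=> [u Gu] [v Gv]; exists (a *: u + v); exact: (@G_lin _ _ _ Gu Gv). Qed.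

Let f_linear (a : R[i]) x y : D x -> D y -> f (a *: x + y) = a *: f x + f y.
Proof.
move=> Dx Dy; apply: (@G_fun (a *: x + y)); first exact/fP/DP.
exact: (@G_lin _ _ _ (fP Dx) (fP Dy)).
Qed.

(* The operator whose graph is the closure of the graph of T *)
Definition closure_op := Operator D0 DP f_linear.
End closure_operator.

Section adjoint.
Variables (T : operator H) (dT : densely_defined T).

Let adj y z := forall x, dom T x -> inner (T x) y = inner x z.

Let adj_fun y z z' : adj y z -> adj y z' -> z = z'.
Proof.
move=> yz yz'; apply/eqP; rewrite -subr_eq0; set w := z - z'.
have w_orth x : dom T x -> inner x w = 0.
  by move=> Tx; rewrite linearBr/= -yz// -yz'// subrr.
apply/negPn/negP => w0; clearbody w.
have w_gt0 : 0 < `|w| by rewrite normr_gt0.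
have [x [wx Tx]] : ball w `|w| `&` dom T !=set0.
  by apply: dT; [exists w; exact: ballxx|exact: ball_open].
have : `|w| ^+ 2 <= `|w - x| ^+ 2.
  have xw := w_orth _ Tx.
  have wx0 : inner w x = 0 by rewrite hermC/= xw rmorph0 mulr0.
  rewrite !sqr_normE linearBr/= !linearBl/= xw wx0 subr0 sub0r opprK.
  by rewrite lerDl -sqr_normE exprn_ge0.
rewrite ler_pXn2r// ?nnegrE//.
by move: wx; rewrite -ball_normE /ball_ /= => /lt_le_trans h /h; rewrite ltxx.
Qed.

Let adj_lin (a : R[i]) x y u v : adj x u -> adj y v ->
  adj (a *: x + y) (a *: u + v).
Proof. by move=> xu yv z Tz; rewrite !linearPr/= xu// yv. Qed.

Let D := [set y | exists z, adj y z].

Let f y := xget 0 [set z | adj y z].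

Let fP y : D y -> adj y (f y).
Proof. exact: (@xgetPex _ 0 [set z | adj y z]). Qed.

Let D0 : D 0. Proof. by exists 0 => x _; rewrite !linear0r. Qed.

Let DP (a : R[i]) x y : D x -> D y -> D (a *: x + y).
Proof. by move=> [u xu] [v yv]; exists (a *: u + v); exact: adj_lin. Qed.

Let f_linear (a : R[i]) x y : D x -> D y -> f (a *: x + y) = a *: f x + f y.
Proof.
move=> Dx Dy; apply: (@adj_fun (a *: x + y)); first exact/fP/DP.
exact: (@adj_lin _ _ _ _ _ (fP Dx) (fP Dy)).
Qed.

(* [adjoint y] is the unique z such that <T x, y> = <x, z> for all x in
   [dom T]; uniqueness is where density of [dom T] is used. *)
Definition adjoint := Operator D0 DP f_linear.
End adjoint.
End operators.

(* Main.v *)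
Require Import Defs.
From HB Require Import structures.
From mathcomp Require Import all_boot all_order all_algebra.
From mathcomp Require Import all_classical all_reals all_analysis.
From mathcomp Require Import complex ring lra.
Set Implicit Arguments.
Unset Strict Implicit.
Unset Printing Implicit Defensive.

(** Closing a product of operators.

    The closure of T is the least closed extension of T, so each inclusion of
    closures reduces to an inclusion of operators together with the closedness
    of the larger one (closure_op_min).

    - Part 1: the product of the closures is contained in the adjoint of the
      product of the adjoints, which is closed (mul_closure_sub_adjoint,
      closed_adjoint). So it is closeable, and its closure is a closed
      extension of A B.
    - Part 2: a closed operator composed with a bounded one on its right is
      closed (closed_mul_op).
    - Part 3: the inclusion puts the domain of the closure of A B inside that of
      the closure of B. The first domain is a Banach space for its graph norm,
      and the closed graph theorem bounds the closure of B on it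
      (closed_graph_relatively_bounded); the bound restricts to B on the domain
      of A B.
    - Part 4: the hypothesis provides a closed extension of the product of the
      closures, and both inclusions follow from minimality.

    The closed graph theorem is proved in the form: a closeable operator S whose
    domain contains that of a closed operator T is T-bounded. Completeness of
    the domain of T enters twice, each time as convergence of sequences whose
    steps decrease geometrically (halving_complete): for the nested balls of the
    Baire argument (graph_baire), and for the series that upgrades the resulting
    approximate bound to an exact one. *)

Import Order.TTheory GRing.Theory Num.Theory numFieldNormedType.Exports.
Local Open Scope classical_set_scope.
Local Open Scope ring_scope.

(** * Continuity of the inner product *)

Section continuous_dot.
Variables (C : numClosedFieldType) (U : normedModType C).
Variable form : {dot U for Num.conj}.
Hypothesis formE : forall x, `|x| ^+ 2 = form x x.

Lemma dot_polarization u v : 4 * form u v =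
  `|u + v| ^+ 2 - `|u - v| ^+ 2
  + 'i * (`|u + 'i *: v| ^+ 2 - `|u - 'i *: v| ^+ 2).
Proof.
have iv : form u ('i *: v) = - 'i * form u v by rewrite linearZr_LR/= conjCi.
rewrite !formE !dnormB !dnormD /= iv rmorphM/= rmorphN/= conjCi.
have := sqrCi C; set j := 'i => jj.
transitivity (2 * (form u v + (form u v)^*)
  + 2 * - (j ^+ 2) * (form u v - (form u v)^*)); last by ring.
by rewrite jj; ring.
Qed.

(** By polarization the form is a combination of squared norms, so its joint
    continuity needs no Cauchy-Schwarz inequality. *)
Lemma continuous_dot : continuous (fun p : U * U => form p.1 p.2 : C).
Proof.
move=> p.
have cn (f : U * U -> U) : continuous f ->
    `|f q| ^+ 2 @[q --> p] --> `|f p| ^+ 2.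
  by move=> cf; exact: (cvgM (cvg_norm (cf p)) (cvg_norm (cf p))).
have cD (a : C) : continuous (fun q : U * U => q.1 + a *: q.2).
  move=> q; apply: cvgD; first exact: cvg_fst.
  by apply: cvgZl_tmp; exact: cvg_snd.
have -> : (fun p : U * U => form p.1 p.2 : C) = (fun q => 4^-1 *
    (`|q.1 + 1 *: q.2| ^+ 2 - `|q.1 + (-1) *: q.2| ^+ 2
     + 'i * (`|q.1 + 'i *: q.2| ^+ 2 - `|q.1 + (- 'i) *: q.2| ^+ 2))).
  apply/funext => q.
  by rewrite scale1r scaleN1r scaleNr -dot_polarization mulKf// pnatr_eq0.
apply: cvgMl_tmp; apply: cvgD; first by apply: cvgB; apply: cn.
by apply: cvgMl_tmp; apply: cvgB; apply: cn.
Qed.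

Lemma closed_dot_eq u v : closed [set p : U * U | form u p.1 = form v p.2].
Proof.
have cf w : continuous (fun x => form w x : C).
  move=> x; have wx : (w, y) @[y --> x] --> (w, x).
    by apply: cvg_pair; [exact: cvg_cst|exact: cvg_id].
  exact: (cvg_comp _ _ wx (@continuous_dot (w, x))).
have -> : [set p : U * U | form u p.1 = form v p.2] =
    (fun p : U * U => form u p.1 - form v p.2 : C) @^-1` [set 0].
  apply/seteqP; split=> p /=; first by move=> ->; rewrite subrr.
  by move/eqP; rewrite subr_eq0 => /eqP.
apply: preimage_closed; last first.
  exact/accessible_closed_set1/hausdorff_accessible/norm_hausdorff.
move=> p _.
have p1 : q.1 @[q --> p] --> p.1 by exact: cvg_fst.
have p2 : q.2 @[q --> p] --> p.2 by exact: cvg_snd.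
by apply: cvgB; [exact: (cvg_comp _ _ p1 (@cf u p.1))
                |exact: (cvg_comp _ _ p2 (@cf v p.2))].
Qed.

End continuous_dot.

(** * Closures, adjoints and products *)

Section operators.
Context {R : realType} {H : hilbertType R}.
Implicit Types S T A B : operator H.

Lemma closed_inner_eq (u v : H) :
  closed [set p : H * H | inner u p.1 = inner v p.2].
Proof. exact: (closed_dot_eq (@sqr_normE R H)). Qed.

Lemma suboperatorE S T : suboperator S T <-> graph S `<=` graph T.
Proof.
split=> [[sST eST] [x y] [/= Sx <-]|sST].
  by split=> /=; [exact: sST|rewrite -eST].
have h x : dom S x -> graph T (x, S x) by move=> Sx; apply: sST.
by split=> x /h[].
Qed.

Lemma suboperator_trans S T A :
  suboperator S T -> suboperator T A -> suboperator S A.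
Proof. by rewrite !suboperatorE; exact: subset_trans. Qed.

Lemma graph_closure T (cT : closeable T) :
  graph (closure_op cT) = closure (graph T).
Proof.
have G_fun x : is_subset1 [set y | closure (graph T) (x, y)].
  have [S clS /suboperatorE/closure_subset] := cT.
  rewrite -(closure_id (graph S)).1// => sG y y' /sG[_ /= <-] /sG[_ /= <-] //.
apply/seteqP; split=> [[x y] [/= Dx <-]|[x y] Gxy].
  exact: (@xgetPex _ 0 [set y | closure (graph T) (x, y)]).
split=> /=; first by exists y.
exact: (@xget_subset1 _ 0 [set y | closure (graph T) (x, y)] _ Gxy (@G_fun x)).
Qed.

Lemma closed_closure_op T (cT : closeable T) : closed_op (closure_op cT).
Proof. by rewrite /closed_op graph_closure; exact: closed_closure. Qed.

Lemma sub_closure_op T (cT : closeable T) : suboperator T (closure_op cT).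
Proof. by rewrite suboperatorE graph_closure; exact: subset_closure. Qed.

Lemma closure_op_min S T (cT : closeable T) :
  closed_op S -> suboperator T S -> suboperator (closure_op cT) S.
Proof.
move=> clS; rewrite !suboperatorE graph_closure => /closure_subset.
by rewrite -(closure_id (graph S)).1.
Qed.

Lemma mul_op_sub A A' B B' : suboperator A A' -> suboperator B B' ->
  suboperator (mul_op A B) (mul_op A' B').
Proof.
move=> [sA eA] [sB eB]; split=> x [/= Bx Ax].
  by split; [exact: sB|rewrite -eB//; exact: sA].
by rewrite -eB// eA.
Qed.

Lemma dense_orthogonal (D : set H) (w : H) :
  dense D -> (forall x, D x -> inner w x = 0) -> w = 0.
Proof.
move=> dD Dw; apply/eqP; rewrite -(dnorm_eq0 inner); apply/negPn/negP => ww.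
pose C : set H := [set x | inner w x = 0].
have clC : closed C.
  have -> : C = (fun x => (x, 0 : H)) @^-1` [set p | inner w p.1 = inner w p.2].
    by apply/seteqP; split => x /=; rewrite linear0r.
  apply: preimage_closed; last exact: closed_inner_eq.
  by move=> x _; apply: cvg_pair; [exact: cvg_id|exact: cvg_cst].
have [x [Cx /Dw]] : (~` C) `&` D !=set0.
  by apply: dD; [exists w; exact/eqP|exact: closed_openC].
exact: Cx.
Qed.

Lemma graph_adjoint T (dT : densely_defined T) : graph (adjoint dT) =
  [set p | forall x, dom T x -> inner (T x) p.1 = inner x p.2].
Proof.
pose adj y z := forall x, dom T x -> inner (T x) y = inner x z.
have adj_fun y : is_subset1 [set z | adj y z].
  move=> z z' /= yz yz'; apply/eqP; rewrite -subr_eq0; apply/eqP.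
  apply: (dense_orthogonal dT) => x Tx.
  by rewrite hermC/= linearBr/= -yz// -yz'// subrr rmorph0 mulr0.
apply/seteqP; split=> [[y z] [/= Dy <-]|[y z] yz].
  exact: (@xgetPex _ 0 [set z | adj y z]).
split=> /=; first by exists z.
exact: (@xget_subset1 _ 0 [set z | adj y z] _ yz (@adj_fun y)).
Qed.

(** The graph is cut out by the conditions <T x, y> = <x, z>, one for each x in
    the domain of T, and each of them is closed in (y, z). *)
Lemma closed_adjoint T (dT : densely_defined T) : closed_op (adjoint dT).
Proof.
rewrite /closed_op graph_adjoint.
have -> : [set p : H * H | forall x, dom T x -> inner (T x) p.1 = inner x p.2]
    = \bigcap_(x in dom T) [set p | inner (T x) p.1 = inner x p.2] by [].
by apply: closed_bigI => x _; exact: closed_inner_eq.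
Qed.

Lemma adjointP T (dT : densely_defined T) x y :
  dom T x -> dom (adjoint dT) y -> inner (T x) y = inner x (adjoint dT y).
Proof.
move=> Tx Dy.
have : graph (adjoint dT) (y, adjoint dT y) by [].
by rewrite graph_adjoint => /(_ _ Tx).
Qed.

(** The adjoint relation passes from T to its closure: for fixed y it is a
    closed condition on the points of the graph. *)
Lemma adjoint_closureP T (dT : densely_defined T) (cT : closeable T) x y :
  dom (closure_op cT) x -> dom (adjoint dT) y ->
  inner y (closure_op cT x) = inner (adjoint dT y) x.
Proof.
move=> Tx Dy.
have : closure (graph T) (x, closure_op cT x) by rewrite -graph_closure.
have sG : graph T `<=` (fun p => (p.2, p.1)) @^-1`
    [set p | inner y p.1 = inner (adjoint dT y) p.2].
  move=> [u _] [/= Tu <-]; rewrite [LHS]hermC [RHS]hermC/=.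
  by rewrite (adjointP Tu Dy).
move=> /(closure_subset sG); rewrite -(closure_id _).1//.
apply: preimage_closed; last exact: closed_inner_eq.
by move=> p _; apply: cvg_pair; [exact: cvg_snd|exact: cvg_fst].
Qed.

(** Moving first the closure of A and then that of B across the inner product
    shows that the product of the closures is a formal adjoint of the product
    of the adjoints. As an adjoint is closed, this makes the product of the
    closures closeable. *)
Lemma mul_closure_sub_adjoint A B (dA : densely_defined A) (cA : closeable A)
    (dB : densely_defined B) (cB : closeable B)
    (dBA : densely_defined (mul_op (adjoint dB) (adjoint dA))) :
  suboperator (mul_op (closure_op cA) (closure_op cB)) (adjoint dBA).
Proof.
rewrite suboperatorE graph_adjoint => -[x z] [[/= Bx ABx] <-] y [Ay BAy].
rewrite -[LHS](@adjoint_closureP _ dB cB x _ Bx BAy).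
by rewrite -(@adjoint_closureP _ dA cA _ y ABx Ay).
Qed.

Lemma bounded_everywhere_continuous T :
  bounded_everywhere T -> continuous (T : H -> H).
Proof.
move=> [DT [M TM]].
have linT : linear (T : H -> H) by move=> a x y; rewrite op_linear// DT.
pose lT : {linear H -> H} :=
  HB.pack (T : H -> H) (GRing.isLinear.Build _ _ _ _ _ linT).
apply: (@bounded_linear_continuous _ _ _ lT); apply/linear_boundedP.
exists `|M|; split=> [|r Mr x]; first exact: normr_real.
rewrite (le_trans (TM x))// -[M * _]ger0_norm ?(le_trans _ (TM x))//.
by rewrite normrM normr_id ler_wpM2r// ltW.
Qed.

(** The graph of the product is the preimage of the graph of A under the
    continuous map (x, y) |-> (B x, y). *)
Lemma closed_mul_op A B :
  closed_op A -> bounded_everywhere B -> closed_op (mul_op A B).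
Proof.
move=> clA bB; have cB := bounded_everywhere_continuous bB.
rewrite /closed_op.
have -> : graph (mul_op A B) = (fun p => (B p.1, p.2)) @^-1` graph A.
  have DB x : dom B x by rewrite bB.1.
  by apply/seteqP; split=> -[x y] [/=] => [[_ ABx] <-|ABx <-].
apply: preimage_closed clA => p _; apply: cvg_pair; last exact: cvg_snd.
have p1 : q.1 @[q --> p] --> p.1 by exact: cvg_fst.
exact: (cvg_comp _ _ p1 (cB p.1)).
Qed.

End operators.

(** * Real-valued norms and geometric sequences *)

Lemma halving_small {R : realType} (r : nat -> R) (e : R) :
  (forall n, r n.+1 <= r n / 2) -> 0 < e -> \forall n \near \oo, r n < e.
Proof.
move=> rS e0; have r_geo n : r n <= geometric (r 0) 2^-1 n.
  elim: n => [|n ih] /=; first by rewrite expr0 mulr1.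
  by rewrite exprSr mulrA (le_trans (rS n))// ler_wpM2r.
have : geometric (r 0) 2^-1 n @[n --> \oo] --> (0 : R).
  by apply: cvg_geometric; rewrite ger0_norm// invf_lt1// ltr1n.
move=> /cvgrPdist_lt/(_ e e0); apply: filterS => n /=.
rewrite sub0r normrN => /(le_lt_trans (ler_norm _)).
exact/le_lt_trans/r_geo.
Qed.

Section real_norm.
Context {R : realType}.

(** Norms are elements of R[i]; estimates with minima, archimedean bounds and
    linear arithmetic are carried out on their real parts. *)
Definition realnorm {V : normedModType R[i]} (x : V) : R := complex.Re `|x|.

Section normed.
Variable V : normedModType R[i].
Implicit Types x y : V.

Lemma norm_realnorm x : `|x| = (realnorm x)%:C%C.
Proof. by rewrite /realnorm RRe_real// normr_real. Qed.

Lemma realnorm_ge0 x : 0 <= realnorm x.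
Proof. by rewrite -lecR -norm_realnorm normr_ge0. Qed.

Lemma realnorm0 : realnorm (0 : V) = 0.
Proof. by rewrite /realnorm normr0. Qed.

Lemma realnorm0_eq0 x : realnorm x = 0 -> x = 0.
Proof. by move=> x0; apply/normr0_eq0; rewrite norm_realnorm x0. Qed.

Lemma realnormN x : realnorm (- x) = realnorm x.
Proof. by rewrite /realnorm normrN. Qed.

Lemma realnormD x y : realnorm (x + y) <= realnorm x + realnorm y.
Proof. by rewrite -lecR rmorphD/= -!norm_realnorm ler_normD. Qed.

Lemma realnormZ (a : R) x : 0 <= a -> realnorm (a%:C%C *: x) = a * realnorm x.
Proof.
move=> a0; apply: complexI; rewrite rmorphM/= -!norm_realnorm normrZ.
by rewrite ger0_norm// lecR.
Qed.

Lemma cvg_halving (u : nat -> V) (l : V) (r : nat -> R) :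
  (forall n, r n.+1 <= r n / 2) -> (forall n, realnorm (l - u n) <= r n) ->
  u @ \oo --> l.
Proof.
move=> rS ul; apply/cvgrPdist_lt => e e0.
have eE : e = (complex.Re e)%:C%C by rewrite RRe_real// gtr0_real.
have e0' : 0 < complex.Re e by rewrite -ltcR -eE.
apply: filterS (halving_small rS e0') => n rn.
by rewrite norm_realnorm eE ltcR (le_lt_trans (ul n)).
Qed.

End normed.

(** Stating the step bound as a sequence r that at least halves at each step,
    rather than as a geometric sequence, gives at every index n an error bound
    relative to r n. The nested balls below, whose radii are not known in
    advance, need this. *)
Lemma halving_complete (V : completeNormedModType R[i]) (u : nat -> V)
    (r : nat -> R) :
  (forall n, r n.+1 <= r n / 2) -> (forall n, realnorm (u n.+1 - u n) <= r n) ->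
  exists2 l, u @ \oo --> l & forall n, realnorm (l - u n) <= 2 * r n.
Proof.
move=> rS ur; have r0 n : 0 <= r n by exact: le_trans (realnorm_ge0 _) (ur n).
have tail n m : realnorm (u (n + m)%N - u n) <= 2 * r n - 2 * r (n + m)%N.
  elim: m => [|m ih]; first by rewrite addn0 !subrr realnorm0.
  have := realnormD (u (n + m).+1 - u (n + m)%N) (u (n + m)%N - u n).
  rewrite addnS subrKA; have := ur (n + m)%N; have := rS (n + m)%N.
  by lra.
have tailr n m : realnorm (u (n + m)%N - u n) <= 2 * r n.
  by apply: (le_trans (tail n m)); have := r0 (n + m)%N; lra.
have r2S n : 2 * r n.+1 <= 2 * r n / 2 by have := rS n; lra.
have /cvg_ex[l ul] : cvg (u @ \oo).
  suff : cauchy (u @ \oo) by exact: cauchy_cvg.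
  apply: cauchy_exP => e e0.
  have eE : e = (complex.Re e)%:C%C by rewrite RRe_real// gtr0_real.
  have e0' : 0 < complex.Re e by rewrite -ltcR -eE.
  have [n _ /(_ n (leqnn n)) rn] := halving_small r2S e0'.
  exists (u n); exists n => // m /= nm; rewrite -ball_normE /ball_/= distrC.
  by rewrite norm_realnorm eE ltcR -(subnKC nm) (le_lt_trans (tailr _ _)).
exists l => // n; apply/ler_addgt0Pr => e e0.
have eC : 0 < e%:C%C by rewrite ltcR.
move/cvgrPdist_lt : ul => /(_ _ eC)[m _ /(_ (n + m)%N)/=].
rewrite leq_addl => /(_ isT); rewrite norm_realnorm ltcR => lu.
have := realnormD (l - u (n + m)%N) (u (n + m)%N - u n).
by rewrite subrKA; have := tailr n m; lra.
Qed.

End real_norm.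

(** * The closed graph theorem for domains of closed operators *)

Section closed_graph.
Context {R : realType} {H : hilbertType R}.
Implicit Types S T : operator H.

Lemma domB T x y : dom T x -> dom T y -> dom T (x - y).
Proof. by move=> Tx Ty; rewrite addrC -scaleN1r; exact: domP. Qed.

Lemma domD T x y : dom T x -> dom T y -> dom T (x + y).
Proof. by move=> Tx Ty; rewrite -[x]scale1r; exact: domP. Qed.

Lemma domZ T a x : dom T x -> dom T (a *: x).
Proof. by move=> Tx; rewrite -[_ *: _]addr0; apply: domP => //; exact: dom0. Qed.

Lemma op_funB T x y : dom T x -> dom T y -> T (x - y) = T x - T y.
Proof.
by move=> Tx Ty; rewrite addrC -scaleN1r op_linear// scaleN1r addrC.
Qed.

Lemma op_funZ T a x : dom T x -> T (a *: x) = a *: T x.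
Proof.
move=> Tx; rewrite -[a *: x]addr0 op_linear//; last exact: dom0.
by rewrite op_fun0 addr0.
Qed.

Lemma closed_op_cvg T (u : nat -> H) x y : closed_op T ->
  (forall n, dom T (u n)) -> u @ \oo --> x -> T (u n) @[n --> \oo] --> y ->
  dom T x /\ T x = y.
Proof.
move=> clT Tu ux Tuy.
apply: (closed_cvg (graph T) clT _ (x, y)
  (cvg_pair ux Tuy : (u n, T (u n)) @[n --> \oo] --> (x, y))).
by apply: nearW => n; split=> /=.
Qed.

Lemma closeable_op_cvg T (u : nat -> H) x y : closeable T ->
  (forall n, dom T (u n)) -> u @ \oo --> x -> T (u n) @[n --> \oo] --> y ->
  dom T x -> T x = y.
Proof.
move=> [S clS [sTS eTS]] Tu ux Tuy Tx.
rewrite eTS//; apply: (closed_op_cvg clS _ ux _).2 => [n|]; first exact: sTS.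
by under eq_fun do rewrite -eTS//.
Qed.

Definition graphnorm T x := realnorm x + realnorm (T x).

Lemma graphnorm0 T : graphnorm T 0 = 0.
Proof. by rewrite /graphnorm op_fun0 !realnorm0 addr0. Qed.

Lemma graphnormBC T x y :
  dom T x -> dom T y -> graphnorm T (x - y) = graphnorm T (y - x).
Proof.
move=> Tx Ty; rewrite /graphnorm !op_funB// -realnormN opprB; congr (_ + _).
by rewrite -realnormN opprB.
Qed.

Lemma graphnormB T x y : dom T x -> dom T y ->
  graphnorm T (x - y) <= graphnorm T x + graphnorm T y.
Proof.
move=> Tx Ty; rewrite /graphnorm op_funB//.
have := realnormD x (- y); have := realnormD (T x) (- T y).
by rewrite !realnormN; lra.
Qed.

Lemma graphnormZ T (a : R) x : dom T x -> 0 <= a ->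
  graphnorm T (a%:C%C *: x) = a * graphnorm T x.
Proof. by move=> Tx a0; rewrite /graphnorm op_funZ// !realnormZ// mulrDr. Qed.

(** Baire category for the domain of T, complete for the graph norm since T is
    closed: the sublevel sets of q cover the domain, so one of them is dense in
    some ball. Otherwise each ball of the domain contains a point at positive
    distance from the n-th sublevel set. This yields balls shrinking to a point
    x of the domain that lies in no sublevel set. *)
Lemma graph_baire T (q : H -> R) : closed_op T ->
  exists (n : nat) x0 (r : R), [/\ dom T x0, 0 < r &
    forall x e, dom T x -> graphnorm T (x - x0) <= r -> 0 < e ->
      exists y, [/\ dom T y, q y <= n%:R & graphnorm T (x - y) < e]].
Proof.
move=> clT; apply: contrapT => no.
pose good (s : H * R) := dom T s.1 /\ 0 < s.2.
pose P n (s t : H * R) := [/\ good t, t.2 <= s.2 / 2, graphnorm T (t.1 - s.1) <= s.2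
  & forall y, dom T y -> q y <= n%:R -> 4 * t.2 < graphnorm T (t.1 - y)].
have step (ns : nat * (H * R)) : exists t, good ns.2 -> P ns.1 ns.2 t.
  case: ns => n [x r]; have [[/= Tx r0]|ng] := pselect (good (x, r)); last first.
    by exists 0.
  apply: contrapT => not_t; apply: no; exists n, x, r; split => // x' e Tx' x'x e0.
  (* The limit x of the construction is within 4 r' of x' in graph norm, namely
     2 r' for x and 2 r' for T x; with r' <= e / 5 this stays below e. *)
  apply: contrapT => far; apply: not_t; exists (x', Num.min (r / 2) (e / 5)).
  move=> _; split => //=.
  - by split=> //=; rewrite lt_min !divr_gt0.
  - by rewrite ge_min lexx.
  move=> y Ty qy; have : e <= graphnorm T (x' - y).
    by rewrite leNgt; apply/negP => ?; apply: far; exists y.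
  have : Num.min (r / 2) (e / 5) <= e / 5 by rewrite ge_min lexx orbT.
  by lra.
have [f fP] := choice step.
pose s := fix s n := if n is m.+1 then f (m, s m) else (0, 1).
have sG n : good (s n).
  elim: n => [|n ih]; first by split=> //=; exact: dom0.
  by have [] := fP (n, s n) ih.
have sP n : P n (s n) (s n.+1) by exact: (fP (n, s n) (sG n)).
have rS n : (s n.+1).2 <= (s n).2 / 2 by have [] := sP n.
have Ts n : dom T (s n).1 by have [] := sG n.
have gs n : graphnorm T ((s n.+1).1 - (s n).1) <= (s n).2 by have [] := sP n.
have [x sx xr] : exists2 x, (s n).1 @[n --> \oo] --> x &
    forall n, realnorm (x - (s n).1) <= 2 * (s n).2.
  apply: halving_complete rS _ => n; apply: le_trans (gs n).
  by rewrite lerDl realnorm_ge0.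
have [y sy yr] : exists2 y, T (s n).1 @[n --> \oo] --> y &
    forall n, realnorm (y - T (s n).1) <= 2 * (s n).2.
  apply: halving_complete rS _ => n; apply: le_trans (gs n).
  by rewrite -op_funB// lerDr realnorm_ge0.
have [Tx Txy] := closed_op_cvg clT Ts sx sy.
(* x lies in the k-th sublevel set, which the (k+1)-st ball avoids. *)
pose k := (Num.truncn (q x)).+1.
have [_ _ _ /(_ x Tx)] := sP k.
have -> : q x <= k%:R by exact/ltW/truncnS_gt.
move=> /(_ isT); rewrite graphnormBC// /graphnorm op_funB// Txy.
by have := xr k.+1; have := yr k.+1; lra.
Qed.

(** The density given by Baire's theorem, moved to the origin. In a ball about
    x0 where the set |S y| <= n is dense, both a point x0 + a u and the centre x0
    are approximated; the difference of the approximants, rescaled,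
    approximates u. *)
Lemma halving_approximation S T : closed_op T -> dom T `<=` dom S ->
  exists2 C : R, 0 <= C & forall u s, dom T u -> 0 < s -> graphnorm T u <= s ->
    exists y, [/\ dom T y, realnorm (S y) <= C * s & graphnorm T (u - y) <= s / 2].
Proof.
move=> clT sTS; have [n [x0 [r [Tx0 r0 near_x0]]]] :=
  graph_baire (fun x => realnorm (S x)) clT.
exists (2 * n%:R / r) => [|u s Tu s0 us].
  by rewrite divr_ge0 ?mulr_ge0// ltW.
have rs0 : 0 <= r / s by rewrite divr_ge0// ltW.
have sr0 : 0 <= s / r by rewrite divr_ge0// ltW.
pose au := (r / s)%:C%C *: u.
have Tau : dom T au by exact: domZ.
have r4 : 0 < r / 4 by rewrite divr_gt0.
have [|y1 [Ty1 qy1 xy1]] := near_x0 (au + x0) (r / 4) (domD Tau Tx0) _ r4.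
  rewrite addrK graphnormZ// -[leRHS](divfK (lt0r_neq0 s0) r).
  by rewrite ler_wpM2l.
have [|y2 [Ty2 qy2 xy2]] := near_x0 x0 (r / 4) Tx0 _ r4.
  by rewrite subrr graphnorm0 ltW.
exists ((s / r)%:C%C *: (y1 - y2)); split.
- exact/domZ/domB.
- rewrite op_funZ ?op_funB ?realnormZ//; [|exact: sTS..|by apply: domB; exact: sTS].
  have := realnormD (S y1) (- S y2); rewrite realnormN => y12.
  have -> : 2 * n%:R / r * s = s / r * (2 * n%:R) by ring.
  by rewrite ler_wpM2l//; apply: (le_trans y12); lra.
have -> : u - (s / r)%:C%C *: (y1 - y2) =
    (s / r)%:C%C *: ((au + x0 - y1) - (x0 - y2)).
  have -> : (au + x0 - y1) - (x0 - y2) = au - (y1 - y2).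
    by rewrite !opprB addrAC addrACA subrr addr0 addrA addrAC.
  rewrite [RHS]scalerBr /au scalerA -rmorphM/= mulrA divfK ?gt_eqF// divff ?gt_eqF//.
  by rewrite scale1r.
rewrite graphnormZ//; last first.
  by apply: domB; apply: domB => //; exact: domD.
have := graphnormB (domB (domD Tau Tx0) Ty1) (domB Tx0 Ty2).
move=> /(ler_wpM2l sr0)/le_trans; apply.
have -> : s / 2 = s / r * (r / 2) by rewrite mulrA divfK// gt_eqF.
by rewrite ler_wpM2l//; lra.
Qed.

(** Halving approximation, applied over and over to the remainder, writes x as
    the sum of a series along which the values of S also converge
    geometrically. Since S is closeable, S x is the sum of these values. *)
Theorem closed_graph_relatively_bounded S T : closed_op T -> closeable S ->
  dom T `<=` dom S -> relatively_bounded S T.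
Proof.
move=> clT cS sTS; split=> //.
have [C C0 approx] := halving_approximation clT sTS.
have step (us : H * R) : exists y, dom T us.1 -> 0 < us.2 ->
    graphnorm T us.1 <= us.2 -> [/\ dom T y, realnorm (S y) <= C * us.2
      & graphnorm T (us.1 - y) <= us.2 / 2].
  case: us => u s /=.
  have [[Tu [s0 us]]|n] := pselect (dom T u /\ 0 < s /\ graphnorm T u <= s).
    by have [y yP] := approx u s Tu s0 us; exists y.
  by exists 0 => Tu s0 us; exfalso; apply: n.
have [g gP] := choice step.
have key x : dom T x -> realnorm (S x) <= 2 * C * graphnorm T x.
  move=> Tx; have : 0 <= graphnorm T x by rewrite addr_ge0 ?realnorm_ge0.
  (* The approximation is only available at positive scales. *)
  rewrite le_eqVlt => /orP[/eqP/esym x0|x0].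
    have /realnorm0_eq0 -> : realnorm x = 0.
      move: x0; rewrite /graphnorm.
      by have := realnorm_ge0 x; have := realnorm_ge0 (T x); lra.
    by rewrite op_fun0 graphnorm0 realnorm0 mulr0.
  pose c n := graphnorm T x / 2 ^+ n.
  have c0 n : 0 < c n by rewrite divr_gt0// exprn_gt0.
  have cS2 n : c n.+1 = c n / 2 by rewrite /c exprSr invfM mulrA.
  (* u n is the remainder left after n approximations. *)
  pose u := fix u n := if n is m.+1 then u m - g (u m, c m) else x.
  have uP n : dom T (u n) /\ graphnorm T (u n) <= c n.
    elim: n => [|n [Tu un]]; first by rewrite /c expr0 divr1.
    have [Tg _ ug] := gP (u n, c n) Tu (c0 n) un.
    by rewrite cS2; split=> //; exact: domB.
  have Tv n : dom T (x - u n) by apply: domB => //; exact: (uP n).1.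
  have [l Sl lr] : exists2 l, S (x - u n) @[n --> \oo] --> l &
      forall n, realnorm (l - S (x - u n)) <= 2 * (C * c n).
    apply: halving_complete => n; first by rewrite cS2 mulrA.
    rewrite -op_funB; [|exact: sTS..].
    have -> : x - u n.+1 - (x - u n) = g (u n, c n).
      by rewrite /= !opprB addrC addrA subrK addrC subrK.
    by have [] := gP (u n, c n) (uP n).1 (c0 n) (uP n).2.
  have -> : S x = l.
    apply: (closeable_op_cvg cS _ _ Sl (sTS _ Tx)) => [n|]; first exact: sTS.
    apply: (@cvg_halving _ _ _ _ c) => n; first by rewrite cS2.
    rewrite opprB addrC subrK; apply: le_trans (uP n).2.
    by rewrite lerDl realnorm_ge0.
  have := lr 0%N; rewrite /= subrr op_fun0 subr0 /c expr0 divr1 mulrA.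
  exact.
exists (2 * C)%:C%C, (2 * C)%:C%C; split; rewrite ?lecR ?mulr_ge0// => x Tx.
by rewrite !norm_realnorm -!rmorphM -rmorphD lecR/= -mulrDr key.
Qed.

End closed_graph.

Theorem lemma3 (R : realType) (H : hilbertType R) (A B : operator H)
    (dA : densely_defined A) (cA : closeable A)
    (dB : densely_defined B) (cB : closeable B)
    (dAB : densely_defined (mul_op A B)) (cAB : closeable (mul_op A B)) :
  [/\ densely_defined (mul_op (adjoint dB) (adjoint dA)) ->
        exists c : closeable (mul_op (closure_op cA) (closure_op cB)),
          suboperator (closure_op cAB) (closure_op c),
      bounded_everywhere (closure_op cB) -> closed_op A ->
        suboperator (closure_op cAB) (mul_op A (closure_op cB)),
      suboperator (closure_op cAB)
          (mul_op (closure_op cA) (closure_op cB)) ->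
        relatively_bounded (closure_op cB) (closure_op cAB) /\
        relatively_bounded B (mul_op A B)
    & suboperator (mul_op (closure_op cA) (closure_op cB))
          (closure_op cAB) ->
        exists c : closeable (mul_op (closure_op cA) (closure_op cB)),
          same_op (closure_op c) (closure_op cAB)].
Proof.
set bA := closure_op cA; set bB := closure_op cB; set bAB := closure_op cAB.
have sAB : suboperator (mul_op A B) (mul_op bA bB).
  by apply: mul_op_sub; exact: sub_closure_op.
split.
- move=> dBA.
  have c : closeable (mul_op bA bB).
    by exists (adjoint dBA); [exact: closed_adjoint|exact: mul_closure_sub_adjoint].
  exists c; apply: closure_op_min; first exact: closed_closure_op.
  exact: suboperator_trans sAB (sub_closure_op c).
- move=> bB_bounded clA; apply: closure_op_min; first exact: closed_mul_op.
  by apply: mul_op_sub; [split|exact: sub_closure_op].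
- move=> sub.
  have bound : relatively_bounded bB bAB.
    apply: closed_graph_relatively_bounded; first exact: closed_closure_op.
      by exists bB; [exact: closed_closure_op|split].
    by move=> x /sub.1[].
  split=> //; split=> [x []//|].
  have [_ [a [b [a0 b0 ab]]]] := bound; exists a, b; split=> // x ABx.
  have [/(_ x ABx) bABx /(_ x ABx) ->] := sub_closure_op cAB.
  by rewrite (sub_closure_op cB).2; [exact: ab|case: ABx].
- move=> sub; have clAB : closed_op bAB by exact: closed_closure_op.
  have c : closeable (mul_op bA bB) by exists bAB.
  have [le1 eq1] := closure_op_min c clAB sub.
  have [le2 _] : suboperator bAB (closure_op c).
    apply: closure_op_min; first exact: closed_closure_op.
    exact: suboperator_trans sAB (sub_closure_op c).
  by exists c; split=> //; apply/seteqP.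
Qed.
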